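(* The matrix multiplication tensor $M_{\langle 2,2,3\rangle}\in\mathbb{C}^{4}\otimes\mathbb{C}^{6}\otimes\mathbb{C}^{6}$ has border rank $\underline{\mathbf{R}}(M_{\langle 2,2,3\rangle})=10$.
   Context: All vector spaces are over $\mathbb{C}$. A tensor $T\in A\otimes B\otimes C$ has rank one if $T=a\otimes b\otimes c$ for nonzero $a\in A$, $b\in B$, $c\in C$. The border rank $\underline{\mathbf{R}}(T)$ is the smallest $r$ such that $T$ is a limit of sums of $r$ rank one tensors. The matrix multiplication tensor $M_{\langle u,v,w\rangle}\in \mathbb{C}^{uv}\otimes\mathbb{C}^{vw}\otimes\mathbb{C}^{wu}$ is $\sum_{i=1}^{u}\sum_{j=1}^{v}\sum_{k=1}^{w} x^i_j\otimes y^j_k\otimes z^k_i$, where $\{x^i_j\}$, $\{y^j_k\}$, $\{z^k_i\}$ are bases of the three factors. *)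

(* Defs.v *)
From mathcomp Require Import all_boot all_order all_algebra.
From mathcomp Require Import complex.
From mathcomp Require Import all_classical all_reals topology normedtype.

Set Implicit Arguments.
Unset Strict Implicit.
Unset Printing Implicit Defensive.

Import GRing.Theory Num.Theory.
Import numFieldNormedType.Exports.

Local Open Scope classical_set_scope.
Local Open Scope ring_scope.

(* With a basis of each factor indexed by the finite types I, J, K, the space
   A (x) B (x) C is the space of coordinate arrays. Everything is stated over a
   numClosedFieldType F because MathComp-Analysis attaches to it the topology of
   its norm; the intended instance is F = R[i] with R : realType. *)
Notation tensor F I J K := {ffun I * J * K -> F}.

Definition tprod (F : numClosedFieldType) (I J K : finType)
    (a : {ffun I -> F}) (b : {ffun J -> F}) (c : {ffun K -> F}) :
    tensor F I J K :=
  [ffun t => a t.1.1 * b t.1.2 * c t.2].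

Definition rank_one (F : numClosedFieldType) (I J K : finType)
    (T : tensor F I J K) : Prop :=
  exists (a : {ffun I -> F}) (b : {ffun J -> F}) (c : {ffun K -> F}),
    [/\ a != 0, b != 0, c != 0 & T = tprod a b c].

Definition sum_of_rank_ones (F : numClosedFieldType) (I J K : finType) (r : nat)
    (T : tensor F I J K) : Prop :=
  exists S : 'I_r -> tensor F I J K,
    (forall l, rank_one (S l)) /\ T = \sum_(l < r) S l.

(* Convergence in the finite-dimensional tensor space is convergence of every
   coordinate. *)
Definition limit_of_rank_one_sums (F : numClosedFieldType) (I J K : finType)
    (r : nat) (T : tensor F I J K) : Prop :=
  exists u : nat -> tensor F I J K,
    (forall n, sum_of_rank_ones r (u n)) /\
    (forall t, u n t @[n --> \oo] --> T t).

Definition is_border_rank (F : numClosedFieldType) (I J K : finType)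
    (T : tensor F I J K) (r : nat) : Prop :=
  limit_of_rank_one_sums r T /\
  forall s : nat, limit_of_rank_one_sums s T -> (r <= s)%N.

Definition std_basis (F : numClosedFieldType) (I : finType) (i : I) :
    {ffun I -> F} :=
  [ffun i' => (i' == i)%:R].

(* x^i_j, y^j_k, z^k_i are the standard basis vectors indexed by (i, j), (j, k),
   (k, i), so the three factors have dimensions uv, vw, wu. *)
Definition matmul_tensor (F : numClosedFieldType) (u v w : nat) :
    tensor F ('I_u * 'I_v)%type ('I_v * 'I_w)%type ('I_w * 'I_u)%type :=
  \sum_(i < u) \sum_(j < v) \sum_(k < w)
    tprod (std_basis F (i, j)) (std_basis F (j, k)) (std_basis F (k, i)).

(* Main.v *)
Require Import Defs.
From mathcomp Require Import all_boot all_order all_algebra.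
From mathcomp Require Import complex.
From mathcomp Require Import all_classical all_reals topology normedtype.
From mathcomp Require Import spectral sequences ring zify.

(** The border rank is at most 10 because the 2 x 3 factor splits into two L-shaped
    triples of entries, and multiplication by a 2 x 2 matrix with one missing entry
    has border rank at most 5: five rank one tensors add up to that partial
    multiplication plus t times a fixed tensor ([bini_sum], [limit_ten]).

    The lower bound is border apolarity. Suppose that T is a limit of tensors
    sum_(l < 9) a_l (x) b_l (x) c_l. The spans E_n of the products a_l (x) b_l in
    A (x) B may be enlarged to dimension 9, and they contain the slices
    sum_l c_l(k) a_l (x) b_l. The Koszul map from E_n (x) A to Lambda^2 A (x) B has
    as image the sum of the nine spaces (a_l /\ A) (x) b_l, hence has rank at most
    9 * 3 = 27; likewise the map from E_n (x) B to A (x) Lambda^2 B has rank at most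
    9 * 5 = 45. Both bounds are closed conditions on E_n, and Grassmannians are
    compact, so there is a 9-dimensional space E that contains the slices of T and
    satisfies both bounds ([border_apolarity]).

    The tensor T has a large symmetry group. Already a one-parameter group of
    diagonal matrices preserves the 6-dimensional span of the slices and acts on
    the 18-dimensional quotient of A (x) B by it with distinct weights. Letting the
    parameter tend to 0 degenerates E, without raising the two ranks, to the span
    of the slices and of three coordinate tensors ([torus_degeneration]).

    Only finitely many candidates are left, and each fails one of the two bounds.
    The kernel of the first Koszul map consists of the arrays in A (x) A (x) B that
    are symmetric in A (x) A and whose slices lie in E. For a coordinate candidate
    all equations of this space say that an entry is zero or that two entries are
    equal, so its dimension is a number of classes of entries, which can be
    counted. In every case one of the two kernels has dimension at most 8
    ([few_positions_fail]), so the rank is at least 36 - 8 = 28 in the first case and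
    at least 54 - 8 = 46 in the second ([candidate_fails]). *)

Set Implicit Arguments.
Unset Strict Implicit.
Unset Printing Implicit Defensive.
Import Order.TTheory GRing.Theory Num.Theory.
Import numFieldNormedType.Exports.

Local Open Scope classical_set_scope.
Local Open Scope ring_scope.

(** * Ranks and Koszul maps over finite index types *)

Section FunctionMatrices.
Variable F : fieldType.
Implicit Types L X Y Z : finType.

(** Arrays over finite types are ranked through the enumerations of their index
    types, so that products of index sets need not be flattened by hand. *)
Definition array_mx X Y (f : X -> Y -> F) : 'M[F]_(#|X|, #|Y|) :=
  \matrix_(i, j) f (enum_val i) (enum_val j).

Definition array_rank X Y (f : X -> Y -> F) := \rank (array_mx f).

Definition independent L X (g : L -> X -> F) :=
  forall c : L -> F, (forall x, \sum_l c l * g l x = 0) -> forall l, c l = 0.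

Lemma eq_array_rank X Y (f g : X -> Y -> F) : f =2 g -> array_rank f = array_rank g.
Proof. by move=> e; congr (\rank _); apply/matrixP=> i j; rewrite !mxE e. Qed.

Lemma sum_enum_val X (h : X -> F) : \sum_(i < #|X|) h (enum_val i) = \sum_x h x.
Proof. by rewrite [RHS](reindex (@enum_val X X)) //; apply: onW_bij; exact: enum_val_bij. Qed.

Lemma sum_pick X (h : X -> F) x : \sum_y h y *+ (x == y) = h x.
Proof.
rewrite (bigD1 x) //= eqxx big1 ?addr0 // => y /negPf.
by rewrite eq_sym => ->.
Qed.

Lemma array_mxM X Y Z (f : X -> Y -> F) (g : Y -> Z -> F) :
  array_mx f *m array_mx g = array_mx (fun x z => \sum_y f x y * g y z).
Proof.
apply/matrixP=> i j; rewrite !mxE -[RHS]sum_enum_val.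
by apply: eq_bigr=> k _; rewrite !mxE.
Qed.

Lemma array_rankM_l X Y Z (f : X -> Y -> F) (g : Y -> Z -> F) :
  (array_rank (fun x z => \sum_y f x y * g y z)%R <= array_rank g)%N.
Proof. by rewrite /array_rank -array_mxM mxrankM_maxr. Qed.

Lemma array_rankM_r X Y Z (f : X -> Y -> F) (g : Y -> Z -> F) :
  (array_rank (fun x z => \sum_y f x y * g y z)%R <= array_rank f)%N.
Proof. by rewrite /array_rank -array_mxM mxrankM_maxl. Qed.

Lemma array_rank_scale X Y (p : X -> F) (q : Y -> F) (f : X -> Y -> F) :
  (array_rank (fun x y => p x * f x y * q y)%R <= array_rank f)%N.
Proof.
have -> : array_rank (fun x y => p x * f x y * q y) =
  array_rank (fun x y => \sum_x' (p x *+ (x == x')) * (\sum_y' f x' y' * (q y *+ (y == y')))).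
  apply: eq_array_rank=> x y; under eq_bigr=> x' _ do rewrite mulrnAl.
  rewrite sum_pick; under eq_bigr=> y' _ do rewrite mulrnAr.
  by rewrite sum_pick mulrA.
by apply: leq_trans (array_rankM_l _ _) (array_rankM_r _ _).
Qed.

(** Rank-nullity: when no nonzero [n] is killed by both [f] and [h], the left
    kernel of [f] embeds through [h] into the functions on [Z]. *)
Lemma leq_array_rank_add X Y Z (f : X -> Y -> F) (h : X -> Z -> F) :
  (forall n : X -> F, (forall y, \sum_x n x * f x y = 0) ->
     (forall z, \sum_x n x * h x z = 0) -> forall x, n x = 0) ->
  (#|X| <= array_rank f + #|Z|)%N.
Proof.
move=> inj; have free : row_free (row_mx (array_mx f) (array_mx h)).
  rewrite -kermx_eq0; apply/rowV0P=> v /sub_kermxP; rewrite mul_mx_row => e0.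
  have [ef eh] : v *m array_mx f = 0 /\ v *m array_mx h = 0.
    by apply: eq_row_mx; rewrite e0 row_mx0.
  have nE (Y' : finType) (f' : X -> Y' -> F) : v *m array_mx f' = 0 ->
      forall y, \sum_x v 0 (enum_rank x) * f' x y = 0.
    move=> e y; have /matrixP/(_ 0 (enum_rank y)) := e; rewrite !mxE => e'.
    rewrite -[RHS]e' -[LHS]sum_enum_val; apply: eq_bigr=> i _.
    by rewrite !mxE enum_valK enum_rankK.
  apply/rowP=> i; rewrite mxE -(enum_valK i).
  exact: (inj _ (nE _ _ ef) (nE _ _ eh)).
rewrite -{1}(eqP free) -mxrank_tr tr_row_mx -addsmxE.
apply: leq_trans (mxrank_adds_leqif _ _) _; rewrite !mxrank_tr leq_add2l.
exact: rank_leq_col.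
Qed.
End FunctionMatrices.

Section Koszul.
Variable F : fieldType.
Implicit Types L I J : finType.

(** The matrix of the map from E (x) A to Lambda^2 A (x) B that antisymmetrizes
    e (x) a in its two factors A, where E is the span of the [g l] in A (x) B and
    elements of Lambda^2 A are antisymmetric arrays on I x I. *)
Definition koszul L I J (g : L -> I * J -> F) (x : L * I) (y : I * I * J) : F :=
  g x.1 (y.1.1, y.2) *+ (y.1.2 == x.2) - g x.1 (y.1.2, y.2) *+ (y.1.1 == x.2).

(** Exchanging A and B turns the Koszul map into the one from E (x) B to
    A (x) Lambda^2 B. *)
Definition flip L I J (g : L -> I * J -> F) (l : L) (x : J * I) : F := g l (x.2, x.1).

(** The image of the Koszul map depends only on the span E and grows with it. *)
Lemma koszul_row_change L L' I J (P : L' -> L -> F) (g : L -> I * J -> F)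
    (g' : L' -> I * J -> F) :
  (forall l' x, g' l' x = \sum_l P l' l * g l x) ->
  (array_rank (koszul g') <= array_rank (koszul g))%N.
Proof.
move=> g'E.
have -> : array_rank (koszul g') = array_rank (fun (x : L' * I) y =>
    \sum_(z : L * I) (P x.1 z.1 *+ (x.2 == z.2)) * koszul g z y).
  apply: eq_array_rank=> -[l' i] [[i1 i2] j]; rewrite /koszul /= !g'E.
  rewrite -(pair_bigA _ (fun l i' => (P l' l *+ (i == i')) *
    (g l (i1, j) *+ (i2 == i') - g l (i2, j) *+ (i1 == i')))) /=.
  rewrite -!sumrMnl -sumrB; apply: eq_bigr=> l _.
  under eq_bigr=> i' _ do rewrite mulrnAl.
  by rewrite sum_pick mulrBr !mulrnAr.
exact: array_rankM_l.
Qed.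

(** Diagonal automorphisms of A and B, and rescalings of the [g l], only rescale
    the basis vectors of the source and of the target of the Koszul map. *)
Lemma koszul_torus L I J (p : L -> F) (a : I -> F) (b : J -> F) (g : L -> I * J -> F) :
  (forall i, a i != 0) ->
  (array_rank (koszul (fun l x => p l * g l x * (a x.1 * b x.2))%R) <= array_rank (koszul g))%N.
Proof.
move=> a0.
have -> : array_rank (koszul (fun l x => p l * g l x * (a x.1 * b x.2))%R) =
  array_rank (fun x y => (p x.1 / a x.2) * koszul g x y * (a y.1.1 * a y.1.2 * b y.2)).
  apply: eq_array_rank=> -[l i] [[i1 i2] j]; rewrite /koszul /=.
  case: (i2 =P i) => [->|_]; case: (i1 =P i) => [->|_];
    rewrite ?mulr0n ?mulr1n ?subrr ?subr0 ?sub0r ?mul0r ?mulr0 ?mul0r //.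
    by field.
  by field.
exact: array_rank_scale.
Qed.

(** The image is the sum of the spaces (a_l /\ A) (x) b_l, and a_l /\ a_l = 0
    makes each of them lose one dimension. The [N] of the proof holds the
    corresponding kernel elements a_l (x) b_l (x) a_l. *)
Lemma koszul_rank_one L I J (a : L -> I -> F) (b : L -> J -> F) :
  (forall l, exists i, a l i != 0) ->
  (array_rank (koszul (fun l x => a l x.1 * b l x.2)%R) + #|L| <= #|L| * #|I|)%N.
Proof.
move=> a0; set g := fun _ => _.
pose N (l' : L) (x : L * I) := a x.1 x.2 *+ (l' == x.1).
have NK : array_mx N *m array_mx (koszul g) = 0.
  rewrite array_mxM; apply/matrixP=> r c; rewrite !mxE.
  move: (enum_val r) (enum_val c) => l' [[i1 i2] j].
  rewrite -(pair_bigA _ (fun l i => N l' (l, i) * koszul g (l, i) (i1, i2, j))) /=.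
  rewrite (bigD1 l') //= [X in _ + X]big1 ?addr0 => [|l /negPf]; last first.
    by rewrite eq_sym /N => e; rewrite big1 // => i _; rewrite /= e mul0r.
  rewrite /N /koszul /g /=.
  under eq_bigr=> i _ do rewrite eqxx mulr1n mulrBr !mulrnAr.
  by rewrite sumrB !sum_pick mulrCA subrr.
have Nfree : \rank (array_mx N) = #|L|.
  have [s sP] := choice a0.
  pose N' (x : L * I) (l : L) := (a l (s l))^-1 *+ (x == (l, s l)).
  have NN' : array_mx N *m array_mx N' = 1%:M.
    rewrite array_mxM; apply/matrixP=> r c; rewrite !mxE -(inj_eq enum_val_inj).
    move: (enum_val r) (enum_val c) => l l'.
    rewrite (bigD1 (l', s l')) //= big1 ?addr0 => [|x /negPf]; last first.
      by rewrite /N' => ->; rewrite mulr0.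
    rewrite /N /N' /= eqxx mulr1n; case: (l =P l') => _.
      by rewrite mulr1n divff.
    by rewrite mulr0n mul0r.
  apply/eqP; rewrite eqn_leq rank_leq_row /=.
  by rewrite -[X in (X <= _)%N](mxrank1 F #|L|) -NN' mxrankM_maxl.
by rewrite -card_prod addnC -{1}Nfree; exact: mulmx0_rank_max NK.
Qed.

(** The kernel of the Koszul map is the intersection of A (x) E with S^2 A (x) B,
    that is, the space of arrays [s] that are symmetric in the first two indices
    and whose slices [s (i, _, _)] lie in E. Entries that determine such an [s]
    bound the dimension of this kernel. *)
Lemma leq_koszul L I J (g : L -> I * J -> F) (zs : seq (I * I * J)) :
  independent g ->
  (forall (s : I * I * J -> F) (n : I -> L -> F),
     (forall i1 i2 j, s (i1, i2, j) = \sum_l n i1 l * g l (i2, j)) ->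
     (forall i1 i2 j, s (i1, i2, j) = s (i2, i1, j)) ->
     (forall z, z \in zs -> s z = 0) -> forall z, s z = 0) ->
  (#|L| * #|I| <= array_rank (koszul g) + size zs)%N.
Proof.
move=> gfree inj.
pose h (x : L * I) (z : 'I_(size zs)) : F :=
  let y := tnth (in_tuple zs) z in g x.1 (y.1.2, y.2) *+ (y.1.1 == x.2).
have := @leq_array_rank_add F _ _ _ (koszul g) h; rewrite card_prod card_ord; apply.
move=> n nk nh.
pose s y := \sum_l n (l, y.1.1) * g l (y.1.2, y.2).
have slice y : \sum_(x : L * I) n x * (g x.1 (y.1.2, y.2) *+ (y.1.1 == x.2)) = s y.
  rewrite (eq_bigr (fun x => n (x.1, x.2) * (g x.1 (y.1.2, y.2) *+ (y.1.1 == x.2)))); last by case.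
  rewrite -(pair_bigA _ (fun l i => n (l, i) * (g l (y.1.2, y.2) *+ (y.1.1 == i)))) /=.
  apply: eq_bigr=> l _; under eq_bigr=> i _ do rewrite mulrnAr.
  by rewrite sum_pick.
have s0 : forall y, s y = 0.
  apply: (inj s (fun i l => n (l, i))) => [//|i1 i2 j|z /seq_tnthP[k zk]].
    apply/eqP; rewrite -subr_eq0; apply/eqP.
    rewrite -(nk (i2, i1, j)) -!slice -sumrB; apply: eq_bigr=> x _.
    by rewrite /koszul /= mulrBr.
  by rewrite -(nh k) /h -slice; apply: eq_bigr=> x _; rewrite zk.
case=> l i; apply: (gfree (fun l => n (l, i))) => -[i2 j].
exact: (s0 (i, i2, j)).
Qed.
End Koszul.

(** * Limits *)

Lemma fmap_ultra (T T' : Type) (f : T -> T') (U : set_system T) :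
  UltraFilter U -> UltraFilter (f @ U).
Proof.
move=> UU; split=> [|G PG UG]; first exact: fmap_proper_filter.
apply/seteqP; split=> // B GB.
have [//|UnB] := in_ultra_setVsetC (f @^-1` B) UU.
by have [x []] := filter_ex (filterI GB (UG (~` B) UnB)).
Qed.

(** Bolzano-Weierstrass. An ultrafilter replaces the choice of a subsequence, so
    that one and the same [U] serves every coordinate of a sequence of arrays. *)
Lemma complex_ultra_cvg (R : realType) (U : set_system nat) (z : nat -> R[i]) :
  UltraFilter U -> (forall n, `|z n| <= 1) ->
  exists l : (R[i] : numClosedFieldType), (z n : (R[i] : numClosedFieldType)) @[n --> U] --> l.
Proof.
move=> UU z1.
have real_cvg (x : nat -> R) : (forall n, `|x n| <= 1) -> exists l : R, x n @[n --> U] --> l.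
  move=> x1; have := @segment_compact R (-1) 1; rewrite compact_ultra => /(_ (x @ U)).
  case; first exact: fmap_ultra.
    have -> : [set` `[(-1 : R), 1]] = [set y | `|y| <= 1].
      by apply/seteqP; split=> y /=; rewrite in_itv /= -ler_norml.
    exact: (@filterE _ U).
  by move=> l [_ xl]; exists l.
have [a aP] : exists a : R, complex.Re (z n) @[n --> U] --> a.
  by apply: real_cvg => n; rewrite -lecR; apply: le_trans (z1 n); exact: normc_ge_Re.
have [b bP] : exists b : R, complex.Im (z n) @[n --> U] --> b.
  apply: real_cvg => n; rewrite -lecR; apply: le_trans (z1 n).
  have := normc_ge_Re (- (z n * 'i%C)); rewrite raddfN /= ReiNIm opprK normrN normrM.
  by rewrite [`|'i%C|]normc_def /= expr0n expr1n /= add0r sqrtr1 mulr1.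
exists (a +i* b)%C; apply/cvgrPdist_le => e; rewrite ltcE /= => /andP[/eqP eI e0].
have e20 : 0 < complex.Re e / 2 by rewrite divr_gt0.
move/cvgrPdist_le: aP => /(_ _ e20) aP; move/cvgrPdist_le: bP => /(_ _ e20) bP.
near=> n.
have -> : e = (complex.Re e / 2)%:C%C + (complex.Re e / 2)%:C%C.
  by rewrite -raddfD /= -splitr; case: (e) eI => x y /= ->.
have -> : (a +i* b)%C - z n = (a - complex.Re (z n))%:C%C + 'i%C * (b - complex.Im (z n))%:C%C.
  by rewrite [LHS]complexE; case: (z n).
apply: le_trans (ler_normD _ _) _; apply: lerD.
  rewrite normc_def /= expr0n /= addr0 sqrtr_sqr lecR; near: n; exact: aP.
rewrite normrM normc_def /= expr0n expr1n /= add0r sqrtr1 mul1r.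
rewrite normc_def /= expr0n /= addr0 sqrtr_sqr lecR; near: n; exact: bP.
Unshelve. all: by end_near. Qed.

Section Limits.
Variable F : numClosedFieldType.

Lemma cvg_sumr (T I : Type) (U : set_system T) (r : seq I) (f : I -> T -> F) (a : I -> F) :
  Filter U -> (forall i, f i t @[t --> U] --> a i) ->
  \sum_(i <- r) f i t @[t --> U] --> \sum_(i <- r) a i.
Proof.
move=> FU fa; apply: cvg_big => //; exact: add_continuous.
Qed.

Lemma cvg_prodr (T I : Type) (U : set_system T) (r : seq I) (f : I -> T -> F) (a : I -> F) :
  Filter U -> (forall i, f i t @[t --> U] --> a i) ->
  \prod_(i <- r) f i t @[t --> U] --> \prod_(i <- r) a i.
Proof.
move=> FU fa; apply: cvg_big => //; exact: mul_continuous.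
Qed.

Lemma cvg_det (T : Type) (U : set_system T) n (M : T -> 'M[F]_n) (M0 : 'M[F]_n) :
  Filter U -> (forall i j, M t i j @[t --> U] --> M0 i j) ->
  \det (M t) @[t --> U] --> \det M0.
Proof.
move=> FU cM; apply: cvg_sumr => s; apply: cvgM; first exact: cvg_cst.
by apply: cvg_prodr => i; exact: cM.
Qed.

Lemma mxrank_mxsub m n p q (f : 'I_p -> 'I_m) (g : 'I_q -> 'I_n) (M : 'M[F]_(m, n)) :
  (\rank (mxsub f g M) <= \rank M)%N.
Proof.
have -> : mxsub f g M = rowsub f 1%:M *m M *m (rowsub g 1%:M)^T.
  rewrite -rowsubE; apply: trmx_inj; rewrite trmx_mul trmxK -rowsubE.
  by apply/matrixP=> i j; rewrite !mxE.
by apply: leq_trans (mxrankM_maxl _ _) (mxrankM_maxr _ _).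
Qed.

Lemma full_rank_minor m n (M : 'M[F]_(m, n)) :
  exists (f : 'I_(\rank M) -> 'I_m) (g : 'I_(\rank M) -> 'I_n), \det (mxsub f g M) != 0.
Proof.
set f := maxrankfun M.
have fu : row_full (rowsub f M)^T by rewrite /row_full mxrank_tr; exact: maxrowsub_free.
exists f, (fullrankfun fu).
have := fullrowsub_unit fu; rewrite unitmxE unitfE -det_tr.
by congr (\det _ != 0); apply/matrixP=> i j; rewrite !mxE.
Qed.

(** A minor that is nonzero in the limit is nonzero nearby. *)
Lemma mxrank_cvg_le (T : Type) (U : set_system T) m n k
    (M : T -> 'M[F]_(m, n)) (M0 : 'M[F]_(m, n)) :
  ProperFilter U -> (forall i j, M t i j @[t --> U] --> M0 i j) ->
  (\forall t \near U, (\rank (M t) <= k)%N) -> (\rank M0 <= k)%N.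
Proof.
move=> PU cM rM; rewrite leqNgt; apply/negP => lt_k.
have [f [g /eqP]] := full_rank_minor M0; apply.
have c1 : \det (mxsub f g (M t)) @[t --> U] --> \det (mxsub f g M0).
  apply: cvg_det => i j; rewrite mxE.
  by under eq_cvg => t do rewrite mxE; exact: cM.
apply: (@cvg_unique F _ (\det (mxsub f g (M t)) @[t --> U])) => //.
have : (fun=> (0:F)) @ U --> (0:F) by exact: cvg_cst.
apply: cvg_trans; apply: near_eq_cvg; near=> t.
apply/esym/eqP; apply: contraTT lt_k; rewrite -unitfE -unitmxE -row_free_unit => /eqP r0.
rewrite -leqNgt -r0; apply: leq_trans (mxrank_mxsub _ _ _) _.
by near: t.
Unshelve. all: by end_near. Qed.

Lemma array_rank_cvg_le (T : Type) (U : set_system T) (X Y : finType) k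
    (f : T -> X -> Y -> F) (f0 : X -> Y -> F) :
  ProperFilter U -> (forall x y, f t x y @[t --> U] --> f0 x y) ->
  (\forall t \near U, (array_rank (f t) <= k)%N) -> (array_rank f0 <= k)%N.
Proof.
move=> PU cf; apply: mxrank_cvg_le => i j; rewrite mxE.
by under eq_cvg => t do rewrite mxE; exact: cf.
Qed.

Lemma koszul_cvg (T : Type) (U : set_system T) (L I J : finType)
    (g : T -> L -> I * J -> F) (g0 : L -> I * J -> F) :
  Filter U -> (forall l x, g t l x @[t --> U] --> g0 l x) ->
  forall x y, koszul (g t) x y @[t --> U] --> koszul g0 x y.
Proof.
move=> FU cg x y; rewrite /koszul; apply: cvgB.
  by case: (_ == _); [exact: cg | exact: cvg_cst].
by case: (_ == _); [exact: cg | exact: cvg_cst].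
Qed.
End Limits.

(** * Border apolarity *)

Lemma row_free_add_row (F : fieldType) k n (w : 'rV[F]_n) (M : 'M[F]_(k, n)) :
  row_free M -> ~~ (w <= M)%MS -> row_free (col_mx w M).
Proof.
move=> Mfree wM.
rewrite -kermx_eq0; apply/rowV0P=> c /sub_kermxP; rewrite -(hsubmxK c) mul_row_col => e.
have c0 : lsubmx c = 0.
  apply/rowP=> i; rewrite (ord1 i) [RHS]mxE; apply/eqP; apply: contraNT wM => nz.
  have -> : w = (- (lsubmx c 0 0)^-1 *: rsubmx c) *m M.
    rewrite -scalemxAl scaleNr -scalerN -(addr0_eq e) opprK.
    by rewrite [X in _ *: (X *m _)]mx11_scalar mul_scalar_mx scalerA mulVf // scale1r.
  exact: submxMl.
move: e; rewrite c0 mul0mx add0r -(mul0mx _ M) => /(row_free_inj Mfree) ->.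
by rewrite row_mx0.
Qed.

Section RankOneFamilies.
Variables (F : fieldType) (I J : finType).

Definition mxfun (L : nat) (M : 'M[F]_(L, #|{: I * J}|)) (l : 'I_L) (x : I * J) : F :=
  M l (enum_rank x).

Definition is_product (v : 'rV[F]_(#|{: I * J}|)) :=
  exists (a : I -> F) (b : J -> F), (exists i, a i != 0) /\
    forall x, mxfun v 0 x = a x.1 * b x.2.

Lemma delta_is_product j : is_product (delta_mx 0 j).
Proof.
pose x := enum_val j.
exists (fun i => (i == x.1)%:R), (fun i => (i == x.2)%:R); split.
  by exists x.1; rewrite eqxx oner_neq0.
move=> [i i']; rewrite /mxfun mxE eqxx /= -natrM mulnb -(inj_eq enum_val_inj) enum_rankK.
by rewrite -/x; case: (x).
Qed.

(** The products a_l (x) b_l of a sum of rank one tensors may be dependent. The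
    redundant ones are traded for standard basis products outside the span, which
    exist as long as the span is not the whole space; this keeps the bound of
    [koszul_rank_one] available in the exact dimension [k]. *)
Lemma free_products k (vs : seq 'rV[F]_(#|{: I * J}|)) :
  (size vs <= k)%N -> (k <= #|{: I * J}|)%N -> {in vs, forall v, is_product v} ->
  exists M : 'M[F]_(k, #|{: I * J}|),
    [/\ row_free M, forall l, is_product (row l M) & {in vs, forall v, (v <= M)%MS}].
Proof.
elim: k vs => [|k IH] vs.
  rewrite leqn0 size_eq0 => /eqP-> _ _; exists 0; split=> //; last by case.
  by rewrite /row_free mxrank0.
move=> vsk kn vsP.
have [||v /mem_behead/vsP //|M [Mfree Mprod Mvs]] := IH (behead vs).
- by rewrite size_behead; case: (size vs) vsk.
- exact: ltnW.
have [w [wP wM wvs]] : exists w, [/\ is_product w, ~~ (w <= M)%MS &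
    {in vs, forall v, (v <= col_mx w M)%MS}].
  have subr (w v : 'rV_ _) : (v <= M)%MS -> (v <= col_mx w M)%MS.
    by move=> vM; apply: submx_trans vM _; rewrite -addsmxE addsmxSr.
  have subl (w : 'rV_ _) : (w <= col_mx w M)%MS by rewrite -addsmxE addsmxSl.
  have [e|/allPn[v vin vM]] := boolP (all (fun v => (v <= M)%MS) vs); last first.
    exists v; split=> //; first exact: vsP.
    case: vs vsk vsP Mvs vin vM => //= v0 vs _ vsP Mvs.
    rewrite inE => /orP[/eqP-> _|/Mvs->//].
    by move=> v'; rewrite inE => /orP[/eqP->//|/Mvs]; exact: subr.
  have [j jM] : exists j, ~~ (delta_mx (0 : 'I_1) j <= M)%MS.
    apply/existsP; rewrite -negb_forall; apply/negP => /forallP all1.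
    have: (1%:M <= M)%MS by apply/row_subP => j; rewrite row1.
    move/mxrankS; rewrite mxrank1 leqNgt => /negP; apply.
    by apply: leq_ltn_trans (rank_leq_row _) _.
  exists (delta_mx 0 j); split=> //; first exact: delta_is_product.
  by move=> v /(allP e); exact: subr.
exists (col_mx w M : 'M_(1 + k, _)); split=> //.
  exact: row_free_add_row.
move=> l; case: (split_ordP (l : 'I_(1 + k))) => i ->.
  have -> : row (lshift k i) (col_mx w M) = w by rewrite rowKu (ord1 i) row_id.
  exact: wP.
have -> : row (rshift 1 i) (col_mx w M) = row i M by rewrite rowKd.
exact: Mprod.
Qed.
End RankOneFamilies.

Lemma lim_eq (F : numClosedFieldType) (T : Type) (U : set_system T) (f h : T -> F) (a b : F) :
  ProperFilter U -> f =1 h -> f t @[t --> U] --> a -> h t @[t --> U] --> b -> a = b.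
Proof.
by move=> PU /funext ->; apply: cvg_unique.
Qed.

Section BorderApolarity.
Variables (R : realType) (I J K : finType).
Local Notation F := (R[i] : numClosedFieldType).
Local Notation N := #|{: I * J}|.

Definition contains_slices (r : nat) (g : 'I_r -> I * J -> F) (T : tensor F I J K) :=
  forall k, exists c : 'I_r -> F, forall x, T (x.1, x.2, k) = \sum_l c l * g l x.

(** Let u_n be sums of [s] rank one tensors that tend to T. The products
    a_l (x) b_l of u_n lie in an [r]-dimensional space E_n spanned by products;
    it contains the slices of u_n, and its Koszul maps have small rank. An
    orthonormal basis of E_n has entries bounded by 1, so along an ultrafilter it
    has a limit, which is again orthonormal. Its span keeps the Koszul ranks, by
    semicontinuity, and contains the slices of T. *)
Lemma border_apolarity (r s : nat) (T : tensor F I J K) :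
  (s <= r)%N -> (r <= #|I| * #|J|)%N -> limit_of_rank_one_sums s T ->
  exists g : 'I_r -> I * J -> F,
    [/\ independent g,
        contains_slices g T,
        (array_rank (koszul g) + r <= r * #|I|)%N &
        (array_rank (koszul (flip g)) + r <= r * #|J|)%N].
Proof.
move=> sr rN [u [ur uT]].
have rN' : (r <= N)%N by rewrite card_prod.
pose slice (T' : tensor F I J K) k : 'rV[F]_N := \row_j T' ((enum_val j).1, (enum_val j).2, k).
have step n : exists G : 'M[F]_(r, N), [/\ G *m (map_mx Num.conj G^T) = 1%:M,
    forall k, (slice (u n) k <= G)%MS,
    (array_rank (koszul (mxfun G)) + r <= r * #|I|)%N &
    (array_rank (koszul (flip (mxfun G))) + r <= r * #|J|)%N].
  have [S [Sr uS]] := ur n.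
  have [a aP] := choice Sr; have {aP}[b aP] := choice aP; have {aP}[c aP] := choice aP.
  pose v l : 'rV[F]_N := \row_j (a l (enum_val j).1 * b l (enum_val j).2).
  have := @free_products F I J r [seq v l | l : 'I_s].
  rewrite size_map size_enum_ord => -[//|//| |M [Mfree Mprod Mv]].
    move=> _ /mapP[l _ ->]; exists (a l), (b l); split=> [|x].
      have [a0 _ _ _] := aP l; apply/existsP; apply: contraNT a0.
      rewrite negb_exists => /forallP a0; apply/eqP/ffunP=> i; rewrite ffunE.
      by apply/eqP; rewrite -[_ == _]negbK.
    by rewrite /mxfun mxE enum_rankK.
  have {}Mprod l : exists p : (I -> F) * (J -> F), (exists i, p.1 i != 0) /\
      forall x, mxfun M l x = p.1 x.1 * p.2 x.2.
    have [a' [b' [a0 ab]]] := Mprod l; exists (a', b'); split=> // x.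
    by rewrite -ab /mxfun mxE.
  have [p pP] := choice Mprod.
  have p2 l : exists j, (p l).2 j != 0.
    apply/existsP; apply: contraT; rewrite negb_exists => /forallP p20.
    have : delta_mx (0 : 'I_1) l *m M = 0 *m M.
      rewrite -rowE mul0mx; apply/rowP=> i; rewrite !mxE -(enum_valK i).
      have -> : M l (enum_rank (enum_val i)) = mxfun M l (enum_val i) by [].
      by rewrite (pP l).2 (eqP (negbNE (p20 _))) mulr0.
    by move/(row_free_inj Mfree)/rowP/(_ l)/eqP; rewrite !mxE !eqxx oner_eq0.
  have [D GD] : exists D, schmidt M = D *m M.
    by apply/submxP; rewrite eqmx_schmidt_free.
  have row_change (l : 'I_r) x : mxfun (schmidt M) l x = \sum_l' D l l' * mxfun M l' x.
    by rewrite {1}/mxfun GD mxE.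
  exists (schmidt M); split.
  - exact/unitarymxP/schmidt_unitarymx.
  - move=> k; rewrite eqmx_schmidt_free //.
    have -> : slice (u n) k = \sum_l c l k *: v l.
      apply/rowP=> j; rewrite mxE uS sum_ffunE summxE; apply: eq_bigr=> l _.
      by have [_ _ _ ->] := aP l; rewrite !mxE ffunE mulrC.
    apply: summx_sub => l _; apply: scalemx_sub; apply: Mv.
    by apply/mapP; exists l; rewrite ?mem_enum.
  - apply: leq_trans (leq_add (koszul_row_change row_change) (leqnn _)) _.
    have := @koszul_rank_one F 'I_r I J (fun l => (p l).1) (fun l => (p l).2).
    rewrite card_ord; move/(_ (fun l => (pP l).1)); apply: leq_trans.
    rewrite leq_add2r leq_eqVlt; apply/orP; left; apply/eqP; apply: eq_array_rank => x y.
    by rewrite /koszul !(pP _).2.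
  - have fc (l : 'I_r) x : flip (mxfun (schmidt M)) l x =
      \sum_l' D l l' * flip (mxfun M) l' x by rewrite /flip row_change.
    apply: leq_trans (leq_add (koszul_row_change fc) (leqnn _)) _.
    have := @koszul_rank_one F 'I_r J I (fun l => (p l).2) (fun l => (p l).1) p2.
    rewrite card_ord; apply: leq_trans.
    rewrite leq_add2r leq_eqVlt; apply/orP; left; apply/eqP; apply: eq_array_rank => x y.
    by rewrite /koszul /flip !(pP _).2 /= ![_ * (p _).2 _]mulrC.
have [G GP] := choice step.
have [U [UU oU]] : exists U : set_system nat, UltraFilter U /\ \oo `<=` U.
  exact: ultraFilterLemma.
have Gbound n l j : `|G n l j| <= 1.
  have [/matrixP/(_ l l) e _ _ _] := GP n.
  move: e; rewrite !mxE eqxx mulr1n => e.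
  rewrite -(@expr_le1 _ 2) // -e (bigD1 j) //= !mxE -normCK lerDl.
  by apply: sumr_ge0 => i _; rewrite !mxE -normCK exprn_ge0.
have [H HP] : exists H : 'I_r -> 'I_N -> F, forall l j, G n l j @[n --> U] --> H l j.
  have lim_ex (p : 'I_r * 'I_N) : exists h : F, G n p.1 p.2 @[n --> U] --> h.
    exact: (@complex_ultra_cvg R U (fun n => G n p.1 p.2)).
  have [H HP] := choice lim_ex.
  by exists (fun l j => H (l, j)) => l j; exact: (HP (l, j)).
have Hc l j : (G n l j)^* @[n --> U] --> (H l j)^*.
  apply/cvgrPdist_le => e e0; have /cvgrPdist_le/(_ e e0) := HP l j.
  by apply: filterS => n; rewrite -rmorphB norm_conjC.
have Hunit l l' : \sum_j H l j * (H l' j)^* = (l == l')%:R.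
  apply: (lim_eq (U := U) (f := fun n => \sum_j G n l j * (G n l' j)^*)
    (h := fun=> (l == l')%:R)) => [n||].
  - have [/matrixP/(_ l l') e _ _ _] := GP n; move: e; rewrite !mxE => <-.
    by apply: eq_bigr => j _; rewrite !mxE.
  - by apply: cvg_sumr => j; exact: cvgM.
  - exact: cvg_cst.
pose g (l : 'I_r) x := H l (enum_rank x).
have gP l x : mxfun (G n) l x @[n --> U] --> g l x by exact: HP.
have shift a b m : (b + r <= m)%N -> (a <= m - r)%N = (a + r <= m)%N by lia.
exists g; split.
- move=> c c0 l.
  (* The inner product of the zero combination with H l is c l. *)
  have cj j : \sum_l c l * H l j = 0.
    by rewrite -(enum_valK j); exact: c0.
  transitivity (\sum_j (\sum_l' c l' * H l' j) * (H l j)^*); last first.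
    by apply: big1 => j _; rewrite cj mul0r.
  under [RHS]eq_bigr => j _ do rewrite mulr_suml.
  rewrite exchange_big /=.
  under [RHS]eq_bigr => l' _ do (under eq_bigr => j _ do rewrite -mulrA; rewrite -mulr_sumr Hunit).
  rewrite (bigD1 l) //= eqxx mulr1 big1 ?addr0 // => l' /negPf ->.
  by rewrite mulr0.
- move=> k; pose c (l : 'I_r) := \sum_j slice T k 0 j * (H l j)^*.
  exists c => x.
  (* For an orthonormal basis G, lying in the span is the closed equation
     slice = slice * G^* * G. *)
  have uU t : u n t @[n --> U] --> T t by apply: cvg_trans (uT t); exact: cvg_app.
  apply: (lim_eq (U := U) (f := fun n => u n (x.1, x.2, k))
    (h := fun n => \sum_l (\sum_j slice (u n) k 0 j * (G n l j)^*) * G n l (enum_rank x))).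
  - move=> n; have [/(_ k)/submxP[D sD] Gu] : _ /\ _ := conj (let: And4 _ h _ _ := GP n in h)
      (let: And4 h _ _ _ := GP n in h).
    have D_ : D = slice (u n) k *m (map_mx Num.conj (G n)^T) by rewrite sD -mulmxA Gu mulmx1.
    transitivity (slice (u n) k 0 (enum_rank x)); first by rewrite mxE enum_rankK.
    rewrite {1}sD {1}D_ mxE; apply: eq_bigr => l _; rewrite mxE; congr (_ * _).
    by apply: eq_bigr => j _; rewrite !mxE.
  - exact: uU.
  - apply: cvg_sumr => l; apply: cvgM; last exact: HP.
    apply: cvg_sumr => j; apply: cvgM; last exact: Hc.
    by rewrite mxE; under eq_cvg => n do rewrite mxE; exact: uU.
- have [_ _ k0 _] := GP 0%N; rewrite -(shift _ _ _ k0).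
  apply: (array_rank_cvg_le (U := U)); first exact: koszul_cvg gP.
  by apply: filterE => n; have [_ _ kn _] := GP n; rewrite (shift _ _ _ kn).
- have [_ _ _ k0] := GP 0%N; rewrite -(shift _ _ _ k0).
  apply: (array_rank_cvg_le (U := U)).
    by apply: koszul_cvg => l x; rewrite /flip; exact: gP.
  by apply: filterE => n; have [_ _ _ kn] := GP n; rewrite (shift _ _ _ kn).
Qed.
End BorderApolarity.

(** * Torus degeneration *)

(** Take a nonzero maximal minor of least total weight and normalize it to the
    identity. If the entry [(l, c)] of the result is nonzero, then replacing the
    column [f l] by [c] gives another nonzero minor, so [c] is not lighter. *)
Lemma minimal_weight_pivots (F : fieldType) m n (M : 'M[F]_(m, n)) (w : 'I_n -> nat) :
  row_free M ->
  exists (P : 'M[F]_m) (f : 'I_m -> 'I_n),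
    (forall l l', (P *m M) l (f l') = (l == l')%:R) /\
    (forall l c, (P *m M) l c != 0 -> (w (f l) <= w c)%N).
Proof.
move=> Mfree.
have [f0 f0P] : exists f0 : {ffun 'I_m -> 'I_n}, colsub f0 M \in unitmx.
  have Mfull : row_full M^T by rewrite /row_full mxrank_tr; exact: Mfree.
  exists (finfun (fullrankfun Mfull)).
  rewrite -unitmx_tr; have := fullrowsub_unit Mfull; congr (_ \in unitmx).
  by apply/matrixP=> i j; rewrite !mxE [in RHS]ffunE.
pose unit_minor (f : {ffun 'I_m -> 'I_n}) := colsub f M \in unitmx.
have := @arg_minnP _ f0 unit_minor (fun f => \sum_l w (f l))%N f0P.
case=> f fP fmin.
exists (invmx (colsub f M)), f; set M' := _ *m M.
have M'f l l' : M' l (f l') = (l == l')%:R.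
  have -> : M' l (f l') = (invmx (colsub f M) *m colsub f M) l l'.
    by rewrite !mxE; apply: eq_bigr => k _; rewrite !mxE.
  by rewrite mulVmx // mxE.
split=> // l c nz; rewrite leqNgt; apply/negP => lt_w.
pose f' : {ffun 'I_m -> 'I_n} := [ffun l' => if l' == l then c else f l'].
have f'P : colsub f' M \in unitmx.
  have -> : colsub f' M = colsub f M *m colsub f' M'.
    have -> : colsub f' M' = invmx (colsub f M) *m colsub f' M.
      by apply/matrixP=> i j; rewrite !mxE; apply: eq_bigr => k _; rewrite !mxE.
    by rewrite mulKVmx.
  rewrite /unit_minor in fP; rewrite unitmx_mul fP /= -row_free_unit -kermx_eq0.
  apply/rowV0P => u /sub_kermxP e.
  have ul l' : l' != l -> u 0 l' = 0.
    move=> ne; have /rowP/(_ l') := e; rewrite !mxE (bigD1 l') //= big1.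
      by rewrite addr0 mxE ffunE (negPf ne) M'f eqxx mulr1.
    by move=> i /negPf ii; rewrite mxE ffunE (negPf ne) M'f ii mulr0.
  apply/rowP=> l'; rewrite [RHS]mxE; have [->|/ul //] := eqVneq l' l.
  have /rowP/(_ l) := e; rewrite !mxE (bigD1 l) //= big1.
    by rewrite addr0 mxE ffunE eqxx => /eqP; rewrite mulf_eq0 (negPf nz) orbF => /eqP.
  by move=> i /ul ->; rewrite mul0r.
have := fmin f' f'P; rewrite leqNgt => /negP; apply.
rewrite [in ltnLHS](bigD1 l) //= [in ltnRHS](bigD1 l) //= ffunE eqxx.
rewrite (eq_bigr (fun l' => w (f l'))) ?ltn_add2r // => l' /negPf ne.
by rewrite ffunE ne.
Qed.

Lemma matmul_tensorE (F : numClosedFieldType) u v w (i i' : 'I_u) (j j' : 'I_v) (k k' : 'I_w) :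
  matmul_tensor F u v w ((i, j), (j', k), (k', i')) = ([&& i == i', j == j' & k == k'])%:R.
Proof.
rewrite /matmul_tensor sum_ffunE (bigD1 i) //= [X in _ + X]big1 ?addr0; last first.
  move=> i0 /negPf ne; rewrite sum_ffunE big1 // => j0 _; rewrite sum_ffunE big1 // => k0 _.
  by rewrite !ffunE /= !xpair_eqE [i == i0]eq_sym ne /= !mul0r.
rewrite sum_ffunE (bigD1 j) //= [X in _ + X]big1 ?addr0; last first.
  move=> j0 /negPf ne; rewrite sum_ffunE big1 // => k0 _.
  by rewrite !ffunE /= !xpair_eqE [j == j0]eq_sym ne andbF !mul0r.
rewrite sum_ffunE (bigD1 k) //= [X in _ + X]big1 ?addr0; last first.
  move=> k0 /negPf ne.
  by rewrite !ffunE /= !xpair_eqE [k == k0]eq_sym ne andbF mulr0 mul0r.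
rewrite !ffunE /= !xpair_eqE !eqxx /= andbT mul1r -natrM mulnb.
rewrite [j' == j]eq_sym [i' == i]eq_sym [k' == k]eq_sym.
by case: (i == i'); case: (j == j'); case: (k == k').
Qed.

Lemma cvg_expr0 (F : numClosedFieldType) n :
  (t ^+ n : F) @[t --> (0 : F)^'] --> ((n == 0%N)%:R : F).
Proof.
case: n => [|n].
  by under eq_cvg => t do rewrite expr0; exact: cvg_cst.
have id0 : (t : F) @[t --> (0 : F)^'] --> 0 by exact: cvg_within.
elim: n => [|n IH]; first by under eq_cvg => t do rewrite expr1.
rewrite -[X in _ --> X](mulr0 0); under eq_cvg => t do rewrite exprS.
exact: cvgM id0 IH.
Qed.

Section Degeneration.
Variable F : numClosedFieldType.
Local Notation A := ('I_2 * 'I_2)%type.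
Local Notation B := ('I_2 * 'I_3)%type.
Local Notation K := ('I_3 * 'I_2)%type.

Definition slice_basis (kap : K) (x : A * B) : F := matmul_tensor F 2 2 3 (x.1, x.2, kap).

(** The entry ((i, 1), (1, k)) belongs to a single slice, so the corners serve as
    pivots of the span of the slices: the remaining eighteen entries are
    coordinates on the quotient of A (x) B by that span. *)
Definition corner (kap : K) : A * B := ((kap.2, 1), (1, kap.1)).
Definition is_corner (x : A * B) := (x.1.2 == 1) && (x.2.1 == 1).

Lemma is_cornerP x : is_corner x -> x = corner (x.2.2, x.1.1).
Proof. by case: x => [[i j] [j' k]] /andP[/= /eqP-> /eqP->]. Qed.

Lemma slice_corner kap kap' : slice_basis kap (corner kap') = (kap == kap')%:R.
Proof.
case: kap kap' => [k i] [k' i']; rewrite /slice_basis matmul_tensorE /= xpair_eqE.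
by rewrite [i' == i]eq_sym [k' == k]eq_sym andbC.
Qed.

(** Weights of a one-parameter group of diagonal matrices. They are constant, equal
    to 9 i + 3 k + 1, on the entries of each slice, so that the group preserves the
    span of the slices. On the entries that are not corners they are
    9 i + 3 k + d with d = j + 1 - j' in {0, 1, 2}, hence pairwise distinct. *)
Definition weight_A (a : A) : nat := (9 * a.1 + a.2)%N.
Definition weight_B (b : B) : nat := (3 * b.2 + (1 - b.1))%N.
Definition weight (x : A * B) : nat := (weight_A x.1 + weight_B x.2)%N.

Lemma weight_inj x y : ~~ is_corner x -> ~~ is_corner y -> weight x = weight y -> x = y.
Proof.
case: x y => [[[i hi] [j hj]] [[j' hj'] [k hk]]] [[[i2 hi2] [j2 hj2]] [[j2' hj2'] [k2 hk2]]].
rewrite /is_corner /weight /weight_A /weight_B /= -!val_eqE /= => cx cy e.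
have [ei ej ej' ek] : [/\ i = i2, j = j2, j' = j2' & k = k2] by split; lia.
subst; congr ((_, _), (_, _)); exact: val_inj.
Qed.

Lemma weight_slice kap x : slice_basis kap x != 0 -> weight x = (9 * kap.2 + 3 * kap.1 + 1)%N.
Proof.
case: kap x => [[k hk] [i hi]] [[[i2 hi2] [j hj]] [[j' hj'] [k2 hk2]]].
rewrite /slice_basis matmul_tensorE -!val_eqE /= /weight /weight_A /weight_B /=.
case: and3P => [[/eqP-> /eqP-> /eqP->] _|_]; last by rewrite eqxx.
lia.
Qed.

Definition candidate (f : 'I_3 -> A * B) (l : K + 'I_3) (x : A * B) : F :=
  match l with inl kap => slice_basis kap x | inr l => (x == f l)%:R end.

(** The span of [g] is the span of the slices plus the space of its elements that
    vanish at the corners; a basis of the latter is put in echelon form for the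
    weight. *)
Lemma complement_basis (g : 'I_9 -> A * B -> F) (X : K -> 'I_9 -> F) :
  independent g ->
  (forall kap x, slice_basis kap x = \sum_l X kap l * g l x) ->
  exists (D : 'I_3 -> 'I_9 -> F) (f : 'I_3 -> A * B),
    let h l x := \sum_l' D l l' * g l' x in
    [/\ forall l x, is_corner x -> h l x = 0,
        forall l l', h l (f l') = (l == l')%:R &
        forall l x, h l x != 0 -> (weight (f l) <= weight x)%N].
Proof.
move=> gfree Xg.
pose GQ := \matrix_(l < 9, c < #|{: K}|) g l (corner (enum_val c)).
pose XM := \matrix_(c < #|{: K}|, l < 9) X (enum_val c) l.
have XG : XM *m GQ = 1%:M.
  apply/matrixP=> c c'; rewrite !mxE -(inj_eq enum_val_inj) -slice_corner Xg.
  by apply: eq_bigr => l _; rewrite !mxE.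
have cardK : #|{: K}| = 6%N by rewrite card_prod !card_ord.
have rQ : \rank GQ = 6%N.
  transitivity #|{: K}| => //; apply/eqP; rewrite eqn_leq rank_leq_col.
  by rewrite -[X in (X <= _)%N](mxrank1 F #|{: K}|) -XG mxrankM_maxr.
have [D0 [D0free D0Q]] : exists D0 : 'M[F]_(3, 9), row_free D0 /\ D0 *m GQ = 0.
  have := row_base_free (kermx GQ); have := eq_row_base (kermx GQ).
  move: (row_base _); rewrite mxrank_ker rQ => D0 D0E D0free.
  by exists D0; split=> //; apply/sub_kermxP; rewrite D0E.
pose G := \matrix_(l < 9, c < #|{: A * B}|) g l (enum_val c).
have Gfree : row_free G.
  rewrite -kermx_eq0; apply/rowV0P => u /sub_kermxP uG; apply/rowP => l.
  rewrite mxE; apply: (gfree (fun l => u 0 l)) => x.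
  have /rowP/(_ (enum_rank x)) := uG; rewrite !mxE => e; rewrite -[RHS]e.
  by apply: eq_bigr => l' _; rewrite mxE enum_rankK.
have Mfree : row_free (D0 *m G) by rewrite /row_free mxrankMfree.
have [P [f [Pf Pw]]] := minimal_weight_pivots (fun c => weight (enum_val c)) Mfree.
exists (fun l l' => (P *m D0) l l'), (fun l => enum_val (f l)) => h.
have hE l x : h l x = (P *m (D0 *m G)) l (enum_rank x).
  by rewrite mulmxA mxE; apply: eq_bigr => l' _; rewrite [G _ _]mxE enum_rankK.
split=> [l x /is_cornerP ->|l l'|l x].
- have : (P *m D0 *m GQ) l (enum_rank (x.2.2, x.1.1)) = 0 by rewrite -mulmxA D0Q mulmx0 mxE.
  rewrite mxE => e; rewrite -[RHS]e; apply: eq_bigr => l' _.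
  by rewrite [GQ _ _]mxE enum_rankK.
- by rewrite hE enum_valK Pf.
- by rewrite hE => /Pw; rewrite enum_rankK.
Qed.

(** Let t act by t ^ weight and rescale the basis of [complement_basis] so that its
    pivots stay equal to 1. All other entries are multiplied by positive powers of
    t, because the weights are distinct, so the basis tends to coordinate arrays as
    t tends to 0, while the slices do not move. For t <> 0 the Koszul ranks are
    those of [g], and they do not increase in the limit. *)
Lemma torus_degeneration (g : 'I_9 -> A * B -> F) (X : K -> 'I_9 -> F) :
  independent g ->
  (forall kap x, slice_basis kap x = \sum_l X kap l * g l x) ->
  exists f : 'I_3 -> A * B,
    [/\ injective f, forall l, ~~ is_corner (f l),
        (array_rank (koszul (candidate f)) <= array_rank (koszul g))%N &
        (array_rank (koszul (flip (candidate f))) <= array_rank (koszul (flip g)))%N].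
Proof.
move=> gfree Xg; have [D [f]] := complement_basis gfree Xg.
pose h l x := \sum_l' D l l' * g l' x.
rewrite -/h /=; case=> h_corner h_f h_w.
have fc l : ~~ is_corner (f l).
  apply/negP => /(h_corner l); rewrite h_f eqxx => /eqP; by rewrite oner_eq0.
exists f.
pose b (l : K + 'I_3) x := match l with inl kap => slice_basis kap x | inr l => h l x end.
pose w0 (l : K + 'I_3) :=
  match l with inl kap => (9 * kap.2 + 3 * kap.1 + 1)%N | inr l => weight (f l) end.
have bw l x : b l x != 0 -> (w0 l <= weight x)%N.
  by case: l => [kap|l] /=; [move/weight_slice-> | exact: h_w].
(* The exponent is a truncated difference, but bw makes it exact wherever b l x
   is nonzero. *)
pose bt (t : F) l x := t ^+ (weight x - w0 l) * b l x.
have bt_torus t : t != 0 -> bt t =2 fun l x =>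
    (t ^+ w0 l)^-1 * b l x * (t ^+ weight_A x.1 * t ^+ weight_B x.2).
  move=> t0 l x; rewrite /bt; have [->|/bw wx] := eqVneq (b l x) 0; first by rewrite !mulr0 mul0r.
  rewrite -exprD -/(weight x) mulrAC -{2}(subnK wx) exprD [_ * t ^+ w0 l]mulrC mulKf //.
  by rewrite expf_neq0.
have bt_cvg l x : bt t l x @[t --> (0 : F)^'] --> candidate f l x.
  have -> : candidate f l x = ((weight x - w0 l == 0)%N)%:R * b l x.
    have [b0|nz] := eqVneq (b l x) 0.
      rewrite b0 mulr0; case: l b0 => [kap|l] //= b0; case: eqP => // e.
      by move: b0; rewrite e h_f eqxx => /eqP; rewrite oner_eq0.
    have wx := bw _ _ nz; rewrite subn_eq0 -[(weight x <= _)%N]andbT -wx -eqn_leq.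
    case: l nz wx => [kap|l] /= nz wx; first by rewrite (weight_slice nz) eqxx mul1r.
    have xc : ~~ is_corner x by apply: contraNN nz => /(h_corner l)->.
    have -> : (weight x == weight (f l)) = (x == f l).
      by apply/eqP/eqP => [/weight_inj|->//]; apply.
    by case: eqP => [->|_]; rewrite ?mul0r // h_f eqxx mulr1.
  by apply: cvgM; [exact: cvg_expr0 | exact: cvg_cst].
have b_comb : exists P : K + 'I_3 -> 'I_9 -> F, forall l x, b l x = \sum_l' P l l' * g l' x.
  exists (fun l => match l with inl kap => X kap | inr l => D l end).
  by case=> [kap|l] x //=; exact: Xg.
case: b_comb => P bP.
split=> //.
- move=> l l' e; apply/eqP; have := h_f l l'; rewrite -e h_f eqxx => /eqP.
  by rewrite eq_sym pnatr_eq1 eqb1.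
- apply: (array_rank_cvg_le (U := (0 : F)^') (f := fun t => koszul (bt t))).
    exact: koszul_cvg bt_cvg.
  apply: filterS (nbhs_dnbhs_neq _) => t t0.
  apply: leq_trans (koszul_row_change bP).
  apply: leq_trans (koszul_torus (fun l => (t ^+ w0 l)^-1) (fun b => t ^+ weight_B b) b
    (a := fun a => t ^+ weight_A a) _); last by move=> i; rewrite expf_neq0.
  rewrite leq_eqVlt; apply/orP; left; apply/eqP; apply: eq_array_rank => x y.
  by rewrite /koszul !bt_torus.
- apply: (array_rank_cvg_le (U := (0 : F)^') (f := fun t => koszul (flip (bt t)))).
    by apply: koszul_cvg => l x; exact: bt_cvg.
  apply: filterS (nbhs_dnbhs_neq _) => t t0.
  have fP l x : flip b l x = \sum_l' P l l' * flip g l' x by exact: bP.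
  apply: leq_trans (koszul_row_change fP).
  apply: leq_trans (koszul_torus (fun l => (t ^+ w0 l)^-1) (fun a => t ^+ weight_A a) (flip b)
    (a := fun b => t ^+ weight_B b) _); last by move=> i; rewrite expf_neq0.
  rewrite leq_eqVlt; apply/orP; left; apply/eqP; apply: eq_array_rank => x y.
  by rewrite /koszul /flip !bt_torus //= ![t ^+ weight_A _ * _]mulrC.
Qed.
End Degeneration.

(** * Counting classes of entries *)

Local Open Scope nat_scope.

(** The combinatorial model of a Koszul kernel. Consider arrays s x x' y, where
    x, x' < 2 n code the pairs (p, j) as 2 p + j and y is a bit, that are symmetric
    in x and x', and each of whose slices e = s x satisfies
    - e (p, j) y = 0 for j <> y, unless the entry is in S;
    - e (p, 0) 0 = e (p, 1) 1, unless the entry on the left is in S.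
    Every equation says that an entry is zero or that two entries are equal. The
    dimension of the solution space is therefore the number of classes of entries,
    under the equalities, that contain no entry forced to be zero. An entry up to
    symmetry is stored with x <= x'. *)
Definition vertex : Type := nat * nat * bool.
Definition mk_vertex (x x' : nat) (y : bool) : vertex := if x <= x' then (x, x', y) else (x', x, y).

Definition merge_classes (P : seq (seq vertex)) (e : vertex * vertex) :=
  flatten [seq c <- P | (e.1 \in c) || (e.2 \in c)] ::
  [seq c <- P | ~~ ((e.1 \in c) || (e.2 \in c))].

Definition forced_zero (S : nat -> bool -> bool) (x : nat) (y : bool) := (odd x != y) && ~~ S x y.

Definition vertices n : seq vertex :=
  [seq (xx.1, xx.2, y) |
     xx <- [seq (x, x') | x <- iota 0 n.*2, x' <- iota x (n.*2 - x)],
     y <- [:: false; true]].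

Definition edges n (S : nat -> bool -> bool) : seq (vertex * vertex) :=
  [seq (mk_vertex x p.*2 false, mk_vertex x p.*2.+1 true) |
     x <- iota 0 n.*2, p <- [seq p <- iota 0 n | ~~ S p.*2 false]].

Definition free_classes n S : seq (seq vertex) :=
  [seq c <- foldl merge_classes [seq [:: v] | v <- vertices n] (edges n S) |
    (c != [::]) && ~~ has (fun v => forced_zero S v.1.1 v.2 || forced_zero S v.1.2 v.2) c].

(** Codes (i, j, j', k) of the eighteen entries ((i, j), (j', k)) that are not
    corners. *)
Definition position : Type := nat * bool * bool * nat.
Definition positions : seq position :=
  [seq (im.1, im.2.1, im.2.2, k) |
     im <- [seq (i, m) | i <- iota 0 2, m <- [:: (false, false); (false, true); (true, false)]],
     k <- iota 0 3].

(** The equations on arrays in A (x) A (x) B never relate entries with different k,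
    those on arrays in A (x) B (x) B never relate entries with different i. The two Koszul kernels thus split into three, respectively two,
    instances of the model above. *)
Definition part210 (S : seq position) k (x : nat) (y : bool) :=
  ((x./2, odd x, y, k) : position) \in S.
Definition part120 (S : seq position) i (x : nat) (y : bool) :=
  ((i, y, odd x, x./2) : position) \in S.

Definition count210 S := sumn [seq size (free_classes 2 (part210 S k)) | k <- iota 0 3].
Definition count120 S := sumn [seq size (free_classes 3 (part120 S i)) | i <- iota 0 2].

Fixpoint sublists (T : Type) k (l : seq T) : seq (seq T) :=
  if l is x :: l' then
    sublists k l' ++ (if k is k'.+1 then [seq x :: s | s <- sublists k' l'] else [::])
  else [:: [::]].

Lemma filter_sublists (T : eqType) (a : pred T) k l :
  count a l <= k -> [seq x <- l | a x] \in sublists k l.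
Proof.
elim: l k => [|x l IH] k //=; rewrite mem_cat; case: (a x) => /= ck.
  case: k ck => // k; rewrite add1n ltnS => /IH al; apply/orP; right.
  exact: map_f.
by rewrite IH.
Qed.

(** The finite check that excludes border rank 9: 988 sets of positions, with at
    most five partitions of fewer than fifty entries for each. *)
Lemma sublists_fail :
  all (fun S => (count210 S <= 8) || (count120 S <= 8)) (sublists 3 positions).
Proof. by vm_compute. Qed.

Lemma eq_free_classes n (f g : nat -> bool -> bool) :
  f =2 g -> free_classes n f = free_classes n g.
Proof.
move=> fg; have eq_edges : edges n f = edges n g.
  congr flatten; apply: eq_map => x; congr map; apply: eq_filter => p.
  by rewrite fg.
rewrite /free_classes eq_edges; apply: eq_filter => c; congr (_ && ~~ _).
by apply: eq_has => v; rewrite /forced_zero !fg.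
Qed.

Lemma few_positions_fail (S : seq position) :
  size S <= 3 -> {subset S <= positions} -> (count210 S <= 8) || (count120 S <= 8).
Proof.
move=> S3 Spos; pose S' := [seq p <- positions | p \in S].
have SS' : S =i S'.
  by move=> p; rewrite mem_filter; case pS: (p \in S) => //=; rewrite Spos.
have S'in : S' \in sublists 3 positions.
  apply: filter_sublists; rewrite -size_filter; apply: leq_trans S3.
  by apply: uniq_leq_size => [|p]; [exact: filter_uniq | rewrite -SS'].
have := allP sublists_fail S' S'in.
have -> : count210 S' = count210 S.
  congr sumn; apply: eq_map => k; congr size; apply: eq_free_classes => x y.
  by rewrite /part210 SS'.
have -> // : count120 S' = count120 S.
congr sumn; apply: eq_map => k; congr size; apply: eq_free_classes => x y.
by rewrite /part120 SS'.
Qed.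

Section FreeClasses.
Variables (V : zmodType) (n : nat) (S : nat -> bool -> bool).
Variable s : nat -> nat -> bool -> V.
Local Notation val v := (s v.1.1 v.1.2 v.2).

Lemma merge_classes_const (P : seq (seq vertex)) (es : seq (vertex * vertex)) :
  {in es, forall e, val e.1 = val e.2} ->
  {in P, forall c, {in c &, forall u v, val u = val v}} ->
  {in foldl merge_classes P es, forall c, {in c &, forall u v, val u = val v}}.
Proof.
elim: es P => [|e es IH] P //= es_val P_val; apply: IH => [e' e'in|].
  by apply: es_val; rewrite inE e'in orbT.
have e_val : val e.1 = val e.2 by apply: es_val; rewrite mem_head.
move=> c; rewrite inE => /predU1P[->|]; last first.
  by rewrite mem_filter => /andP[_ /P_val].
have eq_e v : v \in flatten [seq c <- P | (e.1 \in c) || (e.2 \in c)] -> val v = val e.1.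
  case/flattenP => c'; rewrite mem_filter => /andP[/orP[]ec' /P_val cval] vc'.
    exact: cval.
  by rewrite e_val; exact: cval.
by move=> u v /eq_e -> /eq_e ->.
Qed.

Lemma mem_merge_classes (P : seq (seq vertex)) (es : seq (vertex * vertex)) :
  flatten (foldl merge_classes P es) =i flatten P.
Proof.
elim: es P => [|e es IH] P //= v; rewrite IH /merge_classes /= -flatten_cat.
by apply: perm_mem; apply: perm_flatten; rewrite perm_filterC.
Qed.

Lemma free_classes_determine :
  (forall x x' y, s x x' y = s x' x y) ->
  (forall x x' y, x < n.*2 -> x' < n.*2 -> forced_zero S x' y -> s x x' y = 0%R) ->
  (forall x p, x < n.*2 -> p < n -> ~~ S p.*2 false -> s x p.*2 false = s x p.*2.+1 true) ->
  {in free_classes n S, forall c, val (head (0, 0, false) c) = 0%R} ->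
  forall x x' y, x < n.*2 -> x' < n.*2 -> s x x' y = 0%R.
Proof.
move=> s_sym s_forced_zero s_edge heads0.
have mk_vertex_val x x' y : val (mk_vertex x x' y) = s x x' y by rewrite /mk_vertex; case: ifP.
have verticesP v : (v \in vertices n) = (v.1.1 <= v.1.2 < n.*2).
  apply/allpairsP/idP => [[[[x x'] y] [/allpairsPdep[a [b [+ + [-> ->]]]] _ ->]]|] /=.
    by rewrite !mem_iota /= add0n => an; rewrite (subnKC (ltnW an)) => /andP[-> ->].
  case: v => [[x x'] y] /= /andP[xx' x'n]; have xn := leq_ltn_trans xx' x'n.
  exists ((x, x'), y); split => //=; last by case: y.
  by apply/allpairsPdep; exists x, x'; rewrite !mem_iota /= add0n xn xx' (subnKC (ltnW xn)).
suff all0 v : v.1.1 <= v.1.2 < n.*2 -> val v = 0%R.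
  move=> x x' y xn x'n; rewrite -mk_vertex_val; apply: all0; rewrite /mk_vertex.
  by case: ifPn => [->//|]; rewrite -ltnNge => /ltnW /= ->.
rewrite -verticesP => vn.
set P := foldl merge_classes [seq [:: v] | v <- vertices n] (edges n S).
have P_val : {in P, forall c, {in c &, forall u v, val u = val v}}.
  apply: merge_classes_const => [e|c /mapP[u _ ->] a b].
    case/allpairsPdep => x [p []]; rewrite mem_iota mem_filter mem_iota /= add0n.
    by move=> xn /andP[Sp pn] ->; rewrite !mk_vertex_val; exact: s_edge.
  by rewrite !inE => /eqP-> /eqP->.
have in_P v' : (v' \in flatten P) = (v' \in vertices n).
  by rewrite mem_merge_classes flatten_map1 map_id.
have /flattenP[c cP vc] : v \in flatten P by rewrite in_P.
have [/hasP[u uc /orP du]|nd] :=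
  boolP (has (fun v => forced_zero S v.1.1 v.2 || forced_zero S v.1.2 v.2) c).
  rewrite (P_val c cP v u vc uc).
  have : u \in flatten P by apply/flattenP; exists c.
  rewrite in_P verticesP => /andP[uu un].
  have u1n := leq_ltn_trans uu un.
  by case: du => d; [rewrite s_sym|]; apply: s_forced_zero.
have c0 : c != [::] by apply: contraTneq vc => ->.
have := heads0 c; rewrite mem_filter c0 nd cP => /(_ isT) <-.
by apply: (P_val c) => //; case: (c) c0 => // u c' _; exact: mem_head.
Qed.
End FreeClasses.

Local Open Scope ring_scope.

(** * Failure of the coordinate candidates *)

Definition bit (y : bool) : 'I_2 := inord y.

Lemma bitK y : odd (bit y) = y.
Proof. by rewrite /bit inordK; case: y. Qed.

Lemma bit_surj (j : 'I_2) : bit (odd j) = j.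
Proof. by apply: val_inj; rewrite /= inordK; case: j => -[|[|]]. Qed.

Lemma bit_eq y y' : (bit y == bit y') = (y == y').
Proof. by apply/eqP/eqP => [/(congr1 (fun j : 'I_2 => odd j))|->//]; rewrite !bitK. Qed.

Lemma half_odd_surj n (p : 'I_n.+1) (j : 'I_2) :
  exists2 x, (x < n.+1.*2)%N & p = inord x./2 /\ j = bit (odd x).
Proof.
have [p_lt j_lt] := (ltn_ord p, ltn_ord j); exists (p.*2 + j)%N; first lia.
have -> : (p.*2 + j)./2 = p by lia.
have -> : odd (p.*2 + j) = odd j by rewrite oddD odd_double.
by rewrite inord_val bit_surj.
Qed.

Section Candidates.
Variable F : numClosedFieldType.
Local Notation A := ('I_2 * 'I_2)%type.
Local Notation B := ('I_2 * 'I_3)%type.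
Local Notation K := ('I_3 * 'I_2)%type.
Variable f : 'I_3 -> A * B.
Hypothesis f_inj : injective f.
Hypothesis f_corner : forall l, ~~ is_corner (f l).
Local Notation g := (candidate F f).

Lemma sum_candidate (c : K + 'I_3 -> F) x :
  \sum_l c l * g l x = \sum_kap c (inl kap) * slice_basis F kap x + \sum_l c (inr l) *+ (x == f l).
Proof.
rewrite big_sumType /=; congr (_ + _); apply: eq_bigr => l _.
by rewrite mulr_natr.
Qed.

Lemma candidate_free : independent g.
Proof.
move=> c c0; have cK kap : c (inl kap) = 0.
  have := c0 (corner kap); rewrite sum_candidate [X in _ + X]big1 ?addr0 => [|l _].
    under eq_bigr => kap' _ do rewrite slice_corner mulr_natr eq_sym.
    by rewrite sum_pick.
  case: eqP => // e; have := f_corner l; rewrite -e.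
  by rewrite /is_corner /= ?eqxx.
case=> // l; have := c0 (f l); rewrite sum_candidate big1 ?add0r => [|kap _].
  under eq_bigr => l' _ do rewrite (inj_eq f_inj).
  by rewrite sum_pick.
by rewrite cK mul0r.
Qed.

Lemma span_off_diagonal (c : K + 'I_3 -> F) x :
  x.1.2 != x.2.1 -> (forall l, x != f l) -> \sum_l c l * g l x = 0.
Proof.
case: x => [[i j] [j' k]] /= ne xf; rewrite sum_candidate !big1 ?addr0 // => [l _|[k' i'] _].
  by rewrite (negPf (xf l)).
by rewrite /slice_basis matmul_tensorE /= (negPf ne) andbF mulr0.
Qed.

Lemma span_diagonal (c : K + 'I_3 -> F) (i : 'I_2) (k : 'I_3) :
  (forall l, ((i, bit false), (bit false, k)) != f l) ->
  \sum_l c l * g l ((i, bit false), (bit false, k)) =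
  \sum_l c l * g l ((i, bit true), (bit true, k)).
Proof.
move=> xf; rewrite !sum_candidate; congr (_ + _).
  by apply: eq_bigr => -[k' i'] _; rewrite /slice_basis !matmul_tensorE !eqxx.
rewrite !big1 // => l _; last by rewrite (negPf (xf l)).
case: eqP => // e; have := f_corner l; rewrite -e /is_corner /=.
by have -> : bit true = 1; [apply: val_inj; rewrite /= inordK | rewrite eqxx].
Qed.

Definition code (x : A * B) : position := ((x.1.1 : nat), odd x.1.2, odd x.2.1, (x.2.2 : nat)).
Local Notation S := [seq code (f l) | l : 'I_3].

Lemma not_in_image x : code x \notin S -> forall l, x != f l.
Proof. by move=> xS l; apply: contraNneq xS => ->; apply: map_f; rewrite mem_enum. Qed.

Lemma image_positions : {subset S <= positions}.
Proof.
move=> _ /mapP[l _ ->]; have := f_corner l; move: (f l) => [[i j] [j' k]].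
rewrite /code /= /is_corner /= => nc.
by move: i j j' k nc => [[|[|?]] ?] [[|[|?]] ?] [[|[|?]] ?] [[|[|[|?]]] ?].
Qed.

Definition reps n T : seq vertex := [seq head (0, 0, false)%N c | c <- free_classes n T].

(** For fixed k, the array [t] below is an instance of the model with n = 2, x
    standing for the index (x./2, odd x) of A and y for the first index of B. *)
Lemma koszul_bound210 : (36 <= array_rank (koszul g) + count210 S)%N.
Proof.
pose decA (x : nat) : A := (inord x./2, bit (odd x)).
pose zs : seq (A * A * B) := [seq (decA v.1.1, decA v.1.2, (bit v.2, inord k)) |
  k <- iota 0 3, v <- reps 2 (part210 S k)].
have -> : count210 S = size zs.
  rewrite size_allpairs_dep; congr sumn.
  by apply: eq_map => k; rewrite size_map.
have := @leq_koszul F _ _ _ g zs candidate_free.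
rewrite card_sum !card_prod !card_ord; apply=> s n sE s_sym s_zs [[[i1 j1] [i2 j2]] [j' k]].
have [x xn [-> ->]] := half_odd_surj i1 j1; have [x' x'n [-> ->]] := half_odd_surj i2 j2.
rewrite -(bit_surj j') -(inord_val k).
have k3 := ltn_ord k; move: (k : nat) k3 (odd j') => {}k k3 y.
pose t x x' y := s (decA x, decA x', (bit y, inord k)).
have codeE z y' : (z < 4)%N -> code (decA z, (bit y', inord k)) = (z./2, odd z, y', k).
  by move=> z4; rewrite /code /= !bitK !inordK //; lia.
apply: (@free_classes_determine F 2 (part210 S k) t) => //
  [a b c|a b c an bn /andP[ne bS]|a p an pn pS|c cin].
- exact: s_sym.
- rewrite /t sE; apply: span_off_diagonal; first by rewrite /= bit_eq.
  by apply: not_in_image; rewrite codeE.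
- rewrite /t !sE /decA /= odd_double doubleK uphalf_double.
  apply: span_diagonal; apply: not_in_image.
  have p4 : (p.*2 < 4)%N by lia.
  by move: pS; rewrite /part210 -(codeE _ _ p4) /decA /= odd_double doubleK.
- apply: s_zs; apply/allpairsPdep; exists k, (head (0, 0, false)%N c).
  by rewrite mem_iota k3; split => //; apply: map_f.
Qed.

(** For fixed i the model is instantiated with n = 3, x standing for the index
    (odd x, x./2) of B and y for the second index of A. *)
Lemma koszul_bound120 : (54 <= array_rank (koszul (flip g)) + count120 S)%N.
Proof.
pose decB (x : nat) : B := (bit (odd x), inord x./2).
pose zs : seq (B * B * A) := [seq (decB v.1.1, decB v.1.2, (inord i, bit v.2)) |
  i <- iota 0 2, v <- reps 3 (part120 S i)].
have -> : count120 S = size zs.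
  rewrite size_allpairs_dep; congr sumn.
  by apply: eq_map => k; rewrite size_map.
have flip_free : independent (flip g).
  by move=> c c0; apply: candidate_free => x; case: x => a b; exact: (c0 (b, a)).
have := @leq_koszul F _ _ _ (flip g) zs flip_free.
rewrite card_sum !card_prod !card_ord; apply=> s n sE s_sym s_zs [[[j1 k1] [j2 k2]] [i j']].
have [x xn [-> ->]] := half_odd_surj k1 j1; have [x' x'n [-> ->]] := half_odd_surj k2 j2.
rewrite -(bit_surj j') -(inord_val i).
have i2 := ltn_ord i; move: (i : nat) i2 (odd j') => {}i i2 y.
pose t x x' y := s (decB x, decB x', (inord i, bit y)).
have codeE z y' : (z < 6)%N -> code ((inord i, bit y'), decB z) = (i, y', odd z, z./2).
  by move=> z4; rewrite /code /= !bitK !inordK //; lia.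
apply: (@free_classes_determine F 3 (part120 S i) t) => //
  [a b c|a b c an bn /andP[ne bS]|a p an pn pS|c cin].
- exact: s_sym.
- rewrite /t sE; apply: span_off_diagonal; first by rewrite /= bit_eq eq_sym.
  by apply: not_in_image; rewrite codeE.
- rewrite /t !sE /flip /decB /= odd_double doubleK uphalf_double.
  apply: span_diagonal; apply: not_in_image.
  have p6 : (p.*2 < 6)%N by lia.
  by move: pS; rewrite /part120 -(codeE _ _ p6) /decB /= odd_double doubleK.
- apply: s_zs; apply/allpairsPdep; exists i, (head (0, 0, false)%N c).
  by rewrite mem_iota i2; split => //; apply: map_f.
Qed.

(** One of the two Koszul kernels has dimension at most 8, so the image has
    dimension at least 36 - 8 = 28 or at least 54 - 8 = 46. *)
Lemma candidate_fails :
  (array_rank (koszul g) <= 27)%N -> (array_rank (koszul (flip g)) <= 45)%N -> False.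
Proof.
have := @few_positions_fail S; rewrite size_map size_enum_ord.
move/(_ isT image_positions) => d le1 le2; have := koszul_bound210; have := koszul_bound120.
by case/orP: d => d; lia.
Qed.
End Candidates.

(** * Ten rank one tensors *)

Section Bini.
Variable F : numClosedFieldType.

Definition comb (I : finType) (s : seq (F * I)) : {ffun I -> F} :=
  [ffun x => \sum_(p <- s) p.1 * std_basis F p.2 x].

Lemma comb_neq0 (I : finType) c (x : I) s :
  c != 0 -> x \notin [seq p.2 | p <- s] -> comb ((c, x) :: s) != 0.
Proof.
move=> c0 xs; apply: contraNneq c0 => /ffunP/(_ x).
rewrite !ffunE big_cons /= ffunE eqxx mulr1 big_seq big1 ?addr0 => [->//|p ps].
rewrite ffunE; case: eqP => [e|_]; last by rewrite mulr0.
by case/negP: xs; rewrite e; apply: map_f.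
Qed.

Local Notation A := ('I_2 * 'I_2)%type.
Local Notation B := ('I_2 * 'I_3)%type.
Local Notation K := ('I_3 * 'I_2)%type.
Definition factors : Type := {ffun A -> F} * {ffun B -> F} * {ffun K -> F}.
Local Notation i1 := (ord0 : 'I_2).
Local Notation i2 := (ord_max : 'I_2).

(** The approximate algorithm of Bini, Capovani, Lotti and Romani for the product
    with a 2 x 2 matrix one of whose entries is zero. The entries of this matrix
    are y^c_a, y^c_b and y^{c'}_a, the missing one is y^{c'}_b; the factor 1/t has
    been moved into the x-factors. *)
Definition bini (c c' : 'I_2) (a b : 'I_3) (t : F) : seq factors :=
  [:: (comb [:: (t^-1, (i2, c))],
       comb [:: (1, (c, b)); (t, (c, a))],
       comb [:: (1, (a, i2)); (t, (b, i2))]);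
      (comb [:: (t^-1, (i1, c)); (1, (i1, c'))],
       comb [:: (1, (c', a)); (t, (c, a))],
       comb [:: (1, (a, i1))]);
      (comb [:: (- t^-1, (i1, c)); (- t^-1, (i2, c)); (- 1, (i2, c'))],
       comb [:: (1, (c, b))],
       comb [:: (1, (a, i2))]);
      (comb [:: (- t^-1, (i1, c))],
       comb [:: (1, (c', a))],
       comb [:: (1, (a, i1)); (1, (a, i2)); (t, (b, i1))]);
      (comb [:: (t^-1, (i1, c)); (1, (i2, c'))],
       comb [:: (1, (c, b)); (1, (c', a))],
       comb [:: (1, (a, i2)); (t, (b, i1))])].

Definition product (z : factors) : tensor F A B K := tprod z.1.1 z.1.2 z.2.

Lemma bini_neq0 c c' a b t : c != c' -> a != b -> t != 0 ->
  all (fun z : factors => [&& z.1.1 != 0, z.1.2 != 0 & z.2 != 0]) (bini c c' a b t).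
Proof.
move=> cc ab t0; have [cc' ba] : (c' == c) = false /\ (b == a) = false.
  by split; apply/negbTE; rewrite eq_sym.
by rewrite /= !comb_neq0 ?oppr_eq0 ?invr_eq0 ?oner_neq0 //=
  ?inE ?xpair_eqE ?eqxx ?andbF ?andbT ?orbF ?(negPf cc) ?(negPf ab) ?cc' ?ba.
Qed.

Definition partial (c c' : 'I_2) (a b : 'I_3) : tensor F A B K :=
  \sum_(i < 2) (tprod (std_basis F (i, c)) (std_basis F (c, a)) (std_basis F (a, i)) +
     tprod (std_basis F (i, c)) (std_basis F (c, b)) (std_basis F (b, i)) +
     tprod (std_basis F (i, c')) (std_basis F (c', a)) (std_basis F (a, i))).

Definition bini_error (c c' : 'I_2) (a b : 'I_3) : tensor F A B K :=
  tprod (std_basis F (i1, c')) (std_basis F (c, a)) (std_basis F (a, i1)) +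
  tprod (std_basis F (i2, c)) (std_basis F (c, a)) (std_basis F (b, i2)) +
  tprod (std_basis F (i2, c')) (std_basis F (c, b)) (std_basis F (b, i1)) +
  tprod (std_basis F (i2, c')) (std_basis F (c', a)) (std_basis F (b, i1)).

Lemma sum_ord2 (V : nmodType) (h : 'I_2 -> V) : \sum_(i < 2) h i = h i1 + h i2.
Proof. by rewrite big_ord_recr big_ord1 /=; congr (h _ + _); apply: val_inj. Qed.

Lemma bini_sum c c' a b t x : t != 0 ->
  (\sum_(z <- bini c c' a b t) product z) x = partial c c' a b x + t * bini_error c c' a b x.
Proof.
move=> t0; rewrite sum_ffunE /partial sum_ord2 /bini_error.
rewrite /bini !big_cons big_nil /product /tprod /=.
rewrite !ffunE /= !big_cons !big_nil /= !ffunE.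
by field.
Qed.

Local Notation k1 := (ord0 : 'I_3).
Local Notation k2 := (inord 1 : 'I_3).
Local Notation k3 := (ord_max : 'I_3).

Lemma sum_ord3 (V : nmodType) (h : 'I_3 -> V) : \sum_(i < 3) h i = h k1 + h k2 + h k3.
Proof.
rewrite !big_ord_recr big_ord0 /= add0r; congr (h _ + h _ + _); apply: val_inj => //=.
by rewrite inordK.
Qed.

(** The six entries of the 2 x 3 factor fall into two L-shaped triples, which
    share the middle column. *)
Lemma matmul_partial : matmul_tensor F 2 2 3 = partial i1 i2 k1 k2 + partial i2 i1 k3 k2.
Proof.
rewrite /matmul_tensor /partial -big_split; apply: eq_bigr => i _ /=.
by rewrite sum_ord2 !sum_ord3 (AC (3*3) ((1*2*4)*(6*5*3))).
Qed.

Lemma product_rank_one (z : factors) :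
  [&& z.1.1 != 0, z.1.2 != 0 & z.2 != 0] -> rank_one (product z).
Proof. by case/and3P=> a0 b0 c0; exists z.1.1, z.1.2, z.2. Qed.

Lemma limit_ten (eps : nat -> F) : (forall n, eps n != 0) ->
  eps n @[n --> \oo] --> (0 : F) -> limit_of_rank_one_sums 10 (matmul_tensor F 2 2 3).
Proof.
move=> eps0 epsc.
pose zs n := bini i1 i2 k1 k2 (eps n) ++ bini i2 i1 k3 k2 (eps n).
exists (fun n => \sum_(z <- zs n) product z); split=> [n|x].
  have zs0 : all (fun z : factors => [&& z.1.1 != 0, z.1.2 != 0 & z.2 != 0]) (zs n).
    by rewrite all_cat !bini_neq0 // -val_eqE /= inordK.
  exists (fun l : 'I_10 => product (tnth (in_tuple (zs n)) l)); split=> [l|].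
    by apply: product_rank_one; apply: (allP zs0); exact: mem_tnth.
  by rewrite big_tnth.
have -> : matmul_tensor F 2 2 3 x = matmul_tensor F 2 2 3 x +
    0 * (bini_error i1 i2 k1 k2 x + bini_error i2 i1 k3 k2 x) by rewrite mul0r addr0.
have sumE n : (\sum_(z <- zs n) product z) x = matmul_tensor F 2 2 3 x +
    eps n * (bini_error i1 i2 k1 k2 x + bini_error i2 i1 k3 k2 x).
  by rewrite big_cat matmul_partial [LHS]ffunE !bini_sum // [X in _ = X + _]ffunE mulrDr addrACA.
under eq_cvg => n do rewrite sumE.
by apply: cvgD; [exact: cvg_cst | apply: cvgM => //; exact: cvg_cst].
Qed.
End Bini.

Lemma complex_harmonic_cvg (R : realType) :
  (((n.+1%:R^-1 : R)%:C)%C : (R[i] : numClosedFieldType)) @[n --> \oo] -->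
    (0 : (R[i] : numClosedFieldType)).
Proof.
apply/cvgrPdist_le => e e0; have eR : e = (complex.Re e)%:C%C.
  by rewrite RRe_real // gtr0_real.
have e0' : 0 < complex.Re e by rewrite -ltcR -eR.
have /cvgrPdist_le/(_ _ e0') := @cvg_harmonic R; apply: filterS => n.
by rewrite eR !sub0r !normrN normc_def /= expr0n addr0 sqrtr_sqr lecR.
Qed.

(** For border rank at most 9, a candidate would have Koszul ranks at most
    9 * 4 - 9 = 27 and 9 * 6 - 9 = 45. *)
Lemma border_rank_lower (R : realType) s :
  limit_of_rank_one_sums s (matmul_tensor R[i] 2 2 3) -> (10 <= s)%N.
Proof.
move=> lim; rewrite ltnNge; apply/negP => s9.
have [|g [g_free g_slices r210 r120]] := border_apolarity s9 _ lim.
  by rewrite !card_prod !card_ord.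
have [X XP] := choice g_slices.
have Xg kap x : slice_basis _ kap x = \sum_l X kap l * g l x by exact: XP.
have [f [f_inj f_corner le210 le120]] := torus_degeneration g_free Xg.
move: r210 r120; rewrite !card_prod !card_ord => r210 r120.
apply: (candidate_fails f_inj f_corner).
  by apply: leq_trans le210 _; rewrite -(leq_add2r 9).
by apply: leq_trans le120 _; rewrite -(leq_add2r 9).
Qed.

Theorem theorem1p3 (R : realType) :
  is_border_rank (matmul_tensor R[i] 2 2 3) 10.
Proof.
split; last exact: border_rank_lower.
apply: limit_ten (@complex_harmonic_cvg R) => n.
by rewrite fmorph_eq0 invr_eq0 pnatr_eq0.
Qed.
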